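(* If $\alpha\in\boldsymbol{\mu}\setminus\{1\}$, then \[ T(\alpha)\cap\boldsymbol{\mu}=\begin{cases}\{\alpha\} & \text{if } \alpha=-1,\\ \{\alpha,\alpha^2,-\alpha^2\} & \text{if } \operatorname{ord}(\alpha)\in\{3,6,12\},\\ \{\alpha,\alpha^2\} & \text{otherwise.}\end{cases} \]
   Context: For $\lambda \in \mathbb{C}\setminus\{0,1\}$ let $E_\lambda \colon y^2 = x(x-1)(x-\lambda)$. For $\alpha \in \mathbb{C}\setminus\{0,1\}$ let $P_\alpha(\lambda)$ be a point on $E_\lambda$ with $x$-coordinate $\alpha$ (well defined up to sign), and set $T(\alpha) = \{\lambda \in \mathbb{C}\setminus\{0,1\} : P_\alpha(\lambda) \text{ is a torsion point of } E_\lambda\}$. $\boldsymbol{\mu}=\exp(2\pi i\mathbb{Q})\subseteq\mathbb{C}$ is the group of all roots of unity, and $\operatorname{ord}(\alpha)$ is the multiplicative order of $\alpha\in\boldsymbol{\mu}$. *)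

(* Defs.v *)
From HB Require Import structures.
From mathcomp Require Import all_boot all_order all_algebra.
From mathcomp Require Import ring.
From mathcomp Require Import classical_sets reals.
From mathcomp Require Export complex.

Set Implicit Arguments.
Unset Strict Implicit.
Unset Printing Implicit Defensive.

Import Order.TTheory GRing.Theory Num.Theory.
Local Open Scope ring_scope.
Local Open Scope classical_set_scope.

Section Legendre.
Variables (F : fieldType) (l : F).

(* [None] is the point at infinity O, [Some (x, y)] an affine point. *)
Definition on_legendre (P : option (F * F)) : bool :=
  if P is Some (x, y) then y ^+ 2 == x * (x - 1) * (x - l) else true.

(* Chord-tangent law on y^2 = x^3 - (1 + l) x^2 + l x; the line of slope [m]
   through the two given points meets the curve in a third one, with abscissa
   m^2 + (1 + l) - x1 - x2.  On pairs off the curve the values are junk. *)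
Definition legendre_slope (x1 y1 x2 y2 : F) : F :=
  if x1 == x2
  then (3 * x1 ^+ 2 - 2 * (1 + l) * x1 + l) / (2 * y1)
  else (y2 - y1) / (x2 - x1).

Definition legendre_add (P Q : option (F * F)) : option (F * F) :=
  match P, Q with
  | None, _ => Q
  | _, None => P
  | Some (x1, y1), Some (x2, y2) =>
      if (x1 == x2) && (y1 == - y2) then None
      else
        let m := legendre_slope x1 y1 x2 y2 in
        let x3 := m ^+ 2 + (1 + l) - x1 - x2 in
        Some (x3, m * (x1 - x3) - y1)
  end.

Definition legendre_mul (n : nat) (P : option (F * F)) : option (F * F) :=
  iter n (legendre_add P) None.

Definition legendre_torsion (P : option (F * F)) : Prop :=
  exists2 n : nat, (0 < n)%N & legendre_mul n P = None.

Lemma on_legendre_add (two_neq0 : (2 : F) != 0) (P Q : option (F * F)) :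
  on_legendre P -> on_legendre Q -> on_legendre (legendre_add P Q).
Proof.
case: P => [[x1 y1]|] //; case: Q => [[x2 y2]|] //= /eqP h1 /eqP h2.
case: ifPn => //= nopp; rewrite /legendre_slope.
have [ex|nx] := eqVneq x1 x2.
  subst x2; move: nopp; rewrite eqxx /= => ny.
  have ey : y1 = y2.
    have : (y1 - y2) * (y1 + y2) = 0 by rewrite -subr_sqr h1 h2 subrr.
    by move/eqP; rewrite mulf_eq0 subr_eq0 addr_eq0 (negPf ny) orbF => /eqP.
  have y0 : y1 != 0.
    apply: contraNneq ny => y10; rewrite -ey y10 oppr0; exact: eqxx.
  set m := _ / _.
  have em : m * (2 * y1) = 3 * x1 ^+ 2 - 2 * (1 + l) * x1 + l.
    by rewrite /m divfK // mulf_neq0.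
  apply/eqP; move: em h1; move: m => m em h1.
  apply/eqP; rewrite -subr_eq0; apply/eqP.
  transitivity ((y1 ^+ 2 - x1 * (x1 - 1) * (x1 - l))
    + (m * (2 * y1) - (3 * x1 ^+ 2 - 2 * (1 + l) * x1 + l))
      * (m ^+ 2 + (1 + l) - x1 - x1 - x1)); first by ring.
  by rewrite em h1 !subrr mul0r addr0.
have dx : x2 - x1 != 0 by rewrite subr_eq0 eq_sym.
set m := _ / _.
have em : y2 = y1 + m * (x2 - x1).
  by rewrite /m divfK // addrC subrK.
apply/eqP; move: em h1 h2; move: m => m em h1 h2; subst y2.
apply/eqP; rewrite -subr_eq0 -(mulrI_eq0 _ (mulfI dx)); apply/eqP.
set x3 := _ - x2.
transitivity ((y1 ^+ 2 - x1 * (x1 - 1) * (x1 - l)) * (x2 - x3)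
  + ((y1 + m * (x2 - x1)) ^+ 2 - x2 * (x2 - 1) * (x2 - l)) * (x3 - x1)).
  by rewrite /x3; ring.
by rewrite h1 h2 !subrr !mul0r addr0.
Qed.

End Legendre.

(* Since -(x, y) = (x, -y), the choice of ordinate does not matter. *)
Definition legendre_torsion_params (F : fieldType) (a : F) : set F :=
  [set l | [/\ l != 0, l != 1 &
    exists y : F, on_legendre l (Some (a, y)) /\
                  legendre_torsion l (Some (a, y))]].

(* [0.-unity_root z] holds for every [z], hence the condition [0 < n]. *)
Definition roots_of_unity (F : fieldType) : set F :=
  [set z | exists2 n : nat, (0 < n)%N & n.-unity_root z].
Arguments roots_of_unity F : clear implicits.

(* Main.v *)
Require Import Defs.
From HB Require Import structures.
From mathcomp Require Import all_boot all_order all_algebra.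
From mathcomp Require Import cyclic ring zify.
From mathcomp Require Import boolp.
From mathcomp Require Import classical_sets reals complex.

(** The torsion condition is tested at a single place above 2.  Write P for a
    point of abscissa [alpha] on E_l, with [alpha] and [l] roots of unity.

    Let A be a valuation ring of the field in which 2 is not invertible.  The
    abscissas satisfy x(2Q) = (x^2 - l)^2 / (4 x (x - 1) (x - l)), so a point
    whose abscissa x is not in A has a double of abscissa x / (4a) with a in A:
    repeated doubling never comes back to an earlier point.  The doubling orbit of a torsion point is eventually periodic, hence
    torsion points have abscissas in A ([torsion_integral]).

    Apply this to 2P, when l is not [alpha]: (alpha^2 - l)^2 is divisible by 4
    in A, hence alpha^2 - l by 2.  The only roots of unity congruent to 1 modulo
    2A are 1 and -1 ([unity_eq_pm1]), so l is alpha^2 or -alpha^2.  If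
    l = -alpha^2, put u = alpha^2; then x(2P) = u / (u - 1) and
    x(4P) = (u^2 - u + 1)^2 / (4 u (u - 1)), so that 2 divides u^2 - u + 1, hence
    u^3 + 1, in A.  The same fact on roots of unity gives u^3 = 1 or u^3 = -1.
    Moreover u is not 1, for otherwise alpha = -1 = l, and u is not -1, because 3
    is not in 2A.  Hence [alpha] has order 3, 6 or 12.

    Conversely P has order 2 if l = alpha and order 4 if l = alpha^2, since then
    x(2P) = 0.  For l = -alpha^2 either u^2 - u + 1 = 0 and x(4P) = 0, or
    u^2 + u + 1 = 0 and x(4P) = x(2P), so that 2P has order 3.

    Two ingredients have to be built.  Multiples are defined by repeated
    addition of P on the left, so relating them to doubling needs
    (P + P) + R = P + (P + R) ([legendre_add_double]), an instance of
    associativity that is proved from the chord and tangent formulas.  The ring A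
    is a subring maximal among those that do not contain 1/2
    ([maximal_dyadic]). *)

Set Implicit Arguments.
Unset Strict Implicit.
Unset Printing Implicit Defensive.

Import Order.TTheory GRing.Theory Num.Theory.
Local Open Scope ring_scope.
Local Open Scope classical_set_scope.

(** * The group law of the Legendre curve *)

Section LegendreLaw.
Variables (F : fieldType) (l : F).
Hypotheses (two_neq0 : (2 : F) != 0) (l_neq0 : l != 0) (l_neq1 : l != 1).
Local Notation add := (legendre_add l).
Local Notation mul := (legendre_mul l).
Local Notation on := (on_legendre l).

Definition legendre_opp (P : option (F * F)) : option (F * F) :=
  if P is Some (x, y) then Some (x, - y) else None.
Local Notation opp := legendre_opp.

Definition legendre_cubic' (x : F) : F := 3 * x ^+ 2 - 2 * (1 + l) * x + l.

Lemma eqr_opp_self (y : F) : (y == - y) = (y == 0).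
Proof.
have -> : (y == - y) = (y + y == 0) by rewrite addr_eq0.
by rewrite -mulr2n -mulr_natl mulf_eq0 (negPf two_neq0).
Qed.

Lemma on_legendre_opp P : on (opp P) = on P.
Proof. by case: P => [[x y]|] //=; rewrite sqrrN. Qed.

Lemma legendre_oppK P : opp (opp P) = P.
Proof. by case: P => [[x y]|] //=; rewrite opprK. Qed.

Lemma legendre_addr0 P : add P None = P.
Proof. by case: P => [[x y]|]. Qed.

Lemma legendre_addrN P : add P (opp P) = None.
Proof. by case: P => [[x y]|] //=; rewrite opprK !eqxx. Qed.

Lemma legendre_addNr P : add (opp P) P = None.
Proof. by rewrite -{2}[P]legendre_oppK legendre_addrN. Qed.

Lemma legendre_add_chord x1 y1 x2 y2 : x1 != x2 ->
  add (Some (x1, y1)) (Some (x2, y2)) =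
  let m := (y2 - y1) / (x2 - x1) in let x3 := m ^+ 2 + (1 + l) - x1 - x2 in
  Some (x3, m * (x1 - x3) - y1).
Proof. by move=> nx; rewrite /= /legendre_slope (negPf nx). Qed.

Lemma legendre_add_tangent x y : y != 0 ->
  add (Some (x, y)) (Some (x, y)) =
  let m := legendre_cubic' x / (2 * y) in let x3 := m ^+ 2 + (1 + l) - x - x in
  Some (x3, m * (x - x3) - y).
Proof. by move=> ny; rewrite /= /legendre_slope !eqxx /= eqr_opp_self (negPf ny). Qed.

Lemma eq_abscissa x y y' : on (Some (x, y)) -> on (Some (x, y')) ->
  y' = y \/ y' = - y.
Proof.
move=> /= /eqP h /eqP h'; have : y' ^+ 2 == y ^+ 2 by rewrite h h'.
by rewrite eqf_sqr => /orP[] /eqP ->; [left|right].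
Qed.

Lemma legendre_addC P Q : on P -> on Q -> add P Q = add Q P.
Proof.
case: P => [[x1 y1]|]; case: Q => [[x2 y2]|] // hP hQ.
have [ex|nx] := eqVneq x1 x2.
  subst x2; case: (eq_abscissa hP hQ) => ->//.
  have := legendre_addrN (Some (x1, y1)).
  by have := legendre_addNr (Some (x1, y1)) => /= -> ->.
have nd : x2 - x1 != 0 by rewrite subr_eq0 eq_sym.
have nd' : x1 - x2 != 0 by rewrite subr_eq0.
rewrite !legendre_add_chord // 1?eq_sym //=; congr (Some (_, _)).
  by field; rewrite nd nd'.
by field; rewrite nd nd'.
Qed.

Lemma legendre_oppD P Q : opp (add P Q) = add (opp P) (opp Q).
Proof.
case: P => [[x1 y1]|]; case: Q => [[x2 y2]|] //=.
rewrite eqr_opp; case: ifP => //= _.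
have -> : legendre_slope l x1 (- y1) x2 (- y2) = - legendre_slope l x1 y1 x2 y2.
  rewrite /legendre_slope; case: ifP => _; last by rewrite -opprD mulNr.
  by rewrite mulrN invrN mulrN.
by rewrite sqrrN; congr (Some (_, _)); ring.
Qed.

(** The curve is smooth at its points of order 2 because 0, 1 and [l] are
    distinct. *)
Lemma legendre_smooth x : on (Some (x, 0)) -> legendre_cubic' x != 0.
Proof.
rewrite /= expr0n /= eq_sym !mulf_eq0 -orbA => /or3P[]; rewrite ?subr_eq0 => /eqP ->;
  rewrite /legendre_cubic'.
- by rewrite expr0n /= !mulr0 subrr add0r.
- have -> : 3 * 1 ^+ 2 - 2 * (1 + l) * 1 + l = 1 - l by ring.
  by rewrite subr_eq0 eq_sym.
have -> : 3 * l ^+ 2 - 2 * (1 + l) * l + l = l * (l - 1) by ring.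
by rewrite mulf_neq0 // subr_eq0.
Qed.

(** On the chord of slope m, the cubic minus the square of the line has the
    three abscissas of intersection as roots; this is its derivative at the
    first of them.  It tells when a chord is also the tangent at [(x1, y1)]. *)
Lemma secant_identity x1 y1 x2 y2 : x1 != x2 ->
  on (Some (x1, y1)) -> on (Some (x2, y2)) ->
  let m := (y2 - y1) / (x2 - x1) in
  legendre_cubic' x1 - 2 * y1 * m = (x2 - x1) * (m ^+ 2 + (1 + l) - x1 - x2 - x1).
Proof.
move=> nx /= /eqP h1 /eqP h2.
have nd : x2 - x1 != 0 by rewrite subr_eq0 eq_sym.
set m := _ / _; have em : y2 = y1 + m * (x2 - x1) by rewrite /m divfK // addrC subrK.
move: em h2; move: m => m -> h2; apply: (mulfI nd).
apply/eqP; rewrite -subr_eq0; apply/eqP; rewrite /legendre_cubic'.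
transitivity ((y1 ^+ 2 - x1 * (x1 - 1) * (x1 - l)) -
   ((y1 + m * (x2 - x1)) ^+ 2 - x2 * (x2 - 1) * (x2 - l))); first by ring.
by rewrite h1 h2 !subrr.
Qed.

(** The line through P and R is reflected into the line through -P and P + R, so
    the latter meets the curve again in -R.  When P + R = -P the chord is tangent at
    P, and [secant_identity] gives the slope of the tangent. *)
Lemma legendre_addKl P R : on P -> on R -> add (opp P) (add P R) = R.
Proof.
case: P => [[x1 y1]|] //; case: R => [[x2 y2]|] // hP hR; last first.
  by rewrite legendre_addr0 legendre_addNr.
have hS := on_legendre_add two_neq0 hP hR.
have [ex|nx] := eqVneq x1 x2.
  subst x2; case: (eq_abscissa hP hR) => ?; subst y2; last first.
    by have /= -> := legendre_addrN (Some (x1, y1)).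
  have [y10|ny1] := eqVneq y1 0.
    by subst y1; rewrite /= oppr0 !eqxx /=.
  rewrite legendre_add_tangent //= in hS *; move: hS.
  set t := _ / _; set x4 := _ - x1; set y4 := _ - y1 => hS.
  have [ex|nx] := eqVneq x1 x4.
    (* P is an inflection point: 2P = -P. *)
    move: hS; rewrite {}/y4 -ex subrr mulr0 add0r => _.
    rewrite eqr_opp eqr_opp_self (negPf ny1) /=.
    rewrite /legendre_slope eqxx mulrN invrN mulrN -/(legendre_cubic' x1) -/t.
    by rewrite sqrrN -/x4 -ex subrr mulr0 sub0r opprK.
  rewrite /legendre_slope (negPf nx) /=.
  have nd : x4 - x1 != 0 by rewrite subr_eq0 eq_sym.
  have -> : (y4 - - y1) / (x4 - x1) = - t.
    by apply: (canLR (mulfK nd)); rewrite /y4; ring.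
  by congr (Some (_, _)); rewrite /x4; ring.
have sec := secant_identity nx hP hR.
have nd0 : x2 - x1 != 0 by rewrite subr_eq0 eq_sym.
rewrite legendre_add_chord //= in hS *; move: sec hS => /=.
set m := _ / _; set x3 := _ - x2; set y3 := _ - y1 => sec hS.
have em : y2 = y1 + m * (x2 - x1) by rewrite /m divfK // addrC subrK.
have [ex|nx'] := eqVneq x1 x3.
  rewrite -ex subrr mulr0 in sec.
  have -> : y3 = - y1 by rewrite /y3 -ex subrr mulr0 add0r.
  have [y10|ny1] := eqVneq y1 0.
    (* A chord through a point of order 2 cannot be tangent there. *)
    rewrite y10 in hP; move: (legendre_smooth hP); move/eqP: sec.
    by rewrite y10 mulr0 mul0r subr0 => ->.
  rewrite -!ex eqr_opp eqr_opp_self (negPf ny1) /=.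
  have -> : legendre_slope l x1 (- y1) x1 (- y1) = - m.
    rewrite /legendre_slope eqxx mulrN invrN mulrN -/(legendre_cubic' x1); congr (- _).
    apply: (canLR (mulfK _)); first by rewrite mulf_neq0.
    by move/eqP: sec; rewrite subr_eq0 => /eqP ->; rewrite mulrC.
  have ex2 : m ^+ 2 + (1 + l) - x1 - x1 = x2 by rewrite {2}ex /x3; ring.
  by rewrite sqrrN ex2 em; congr (Some (_, _)); ring.
have nd : x3 - x1 != 0 by rewrite subr_eq0 eq_sym.
rewrite /legendre_slope (negPf nx') /=.
have -> : (y3 - - y1) / (x3 - x1) = - m.
  by apply: (canLR (mulfK nd)); rewrite /y3; ring.
by rewrite em; congr (Some (_, _)); rewrite /x3; ring.
Qed.

(** Once the degenerate positions are removed by means of [legendre_addKl], both sides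
    are given by explicit chords.  With m the slope of the chord PR and t that of
    the tangent at P, the relation [secant_identity] reads
    (x2 - x1) (x3 - x1) = 2 y1 (t - m), and it allows y1, y2 and l to be expressed
    through x1, x2, x3, m and t: what remains holds identically in these five
    quantities. *)
Lemma legendre_add_double P R : on P -> on R -> add (add P P) R = add P (add P R).
Proof.
move=> hP hR; have hPP := on_legendre_add two_neq0 hP hP.
have hPR := on_legendre_add two_neq0 hP hR.
have [PR|nPR] := eqVneq P R; first by subst R; rewrite legendre_addC.
have [RN|nRN] := eqVneq R (opp P).
  subst R; rewrite legendre_addrN legendre_addr0.
  by rewrite legendre_addC ?on_legendre_opp // legendre_addKl.
have [SN|nSN] := eqVneq (add P R) (opp P).
  rewrite SN legendre_addrN -(legendre_addKl hP hR).
  by rewrite SN -legendre_oppD legendre_addrN.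
have [PSP|nSP] := eqVneq (add P R) P.
  have := legendre_addKl hP hR; rewrite PSP legendre_addNr => <-.
  by rewrite !legendre_addr0.
have nDN : add P P != opp R.
  apply: contraNneq nSN => DN; rewrite -[R]legendre_oppK -DN legendre_oppD.
  by rewrite -{1}[P]legendre_oppK legendre_addKl ?on_legendre_opp.
case: P hP hPP hPR nPR nRN nSN nSP nDN => [[x1 y1]|] // hP.
case: R hR => [[x2 y2]|] // hR; last by rewrite !legendre_addr0.
have [y10|ny1] := eqVneq y1 0.
  subst y1; have oppP : opp (Some (x1, 0)) = Some (x1, 0) by rewrite /= oppr0.
  move=> _ _ _ _ _ _ _; rewrite -{1}oppP legendre_addNr /=.
  by have := legendre_addKl hP hR; rewrite oppP /= => ->.
rewrite legendre_add_tangent //.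
have [ex|nx] := eqVneq x1 x2.
  subst x2; case: (eq_abscissa hP hR) => -> _ _ /=; first by rewrite eqxx.
  by rewrite eqxx.
have sec := secant_identity nx hP hR; rewrite legendre_add_chord //=; move: sec => /=.
set t := legendre_cubic' x1 / (2 * y1); set m := (y2 - y1) / (x2 - x1).
set x4 := t ^+ 2 + (1 + l) - x1 - x1; set y4 := t * (x1 - x4) - y1.
set x3 := m ^+ 2 + (1 + l) - x1 - x2; set y3 := m * (x1 - x3) - y1.
move=> sec hPP hPR _ _ nSN nSP nDN.
have nx3 : x1 != x3.
  apply/eqP => ex; rewrite -ex in hPR nSN nSP.
  by case: (eq_abscissa hP hPR) => ey; [move: nSP|move: nSN]; rewrite ey eqxx.
have nd : x2 - x1 != 0 by rewrite subr_eq0 eq_sym.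
have ne : x3 - x1 != 0 by rewrite subr_eq0 eq_sym.
have em : y2 = y1 + m * (x2 - x1) by rewrite /m divfK // addrC subrK.
have et : (x2 - x1) * (x3 - x1) = 2 * y1 * (t - m).
  rewrite -sec mulrBr; congr (_ - _); rewrite /t mulrC divfK //.
  by rewrite mulf_neq0.
have e4 : x4 = x2 + x3 - x1 + t ^+ 2 - m ^+ 2 by rewrite /x4 /x3; ring.
have eA : 1 + l = x1 + x2 + x3 - m ^+ 2 by rewrite /x3; ring.
have nmt : t - m != 0.
  by apply: contraNneq (mulf_neq0 nd ne) => e0; rewrite et e0 mulr0.
have ey1 : y1 = (x2 - x1) * (x3 - x1) / (2 * (t - m)).
  apply: (canRL (mulfK _)); first by rewrite mulf_neq0.
  by rewrite et; ring.
rewrite /legendre_slope (negPf nx3) /=.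
have [ex|nx4] := eqVneq x4 x2; last first.
  have nd4 : x2 - x4 != 0 by rewrite subr_eq0 eq_sym.
  clear nx3 nx4 et sec hPP hPR nSN nSP nDN hP hR; rewrite /y4 /y3; clear y4 y3.
  clearbody t m; rewrite eA; clear eA; clearbody x3; subst x4 y2.
  rewrite e4 in nd4 *; rewrite {}ey1 in ny1 *.
  by congr (Some (_, _)); field; rewrite ne nmt two_neq0 nd4.
(* There remains 2P = R, where the left-hand side is again a tangent. *)
subst x2.
have ey4 : y4 = y2.
  by case: (eq_abscissa hPP hR) => // ey; case/negP: nDN; rewrite ey /= opprK.
have ny4 : y4 != 0.
  by apply: contraNneq nDN => y40; rewrite -ey4 y40 /= oppr0.
have nd4 : x4 - x1 != 0 by [].
have e2y : 2 * y1 = - (m + t) * (x4 - x1).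
  transitivity (- (m + t) * (x4 - x1) + (y2 - y4)); first by rewrite em /y4; ring.
  by rewrite ey4 subrr addr0.
have {}ey1 : y1 = - (m + t) * (x4 - x1) / 2.
  by apply: (canRL (mulfK two_neq0)); rewrite mulrC.
have e3 : x3 = x1 + m ^+ 2 - t ^+ 2.
  transitivity ((x4 + x3 - x1 + t ^+ 2 - m ^+ 2) - x4 + x1 + m ^+ 2 - t ^+ 2).
    by ring.
  by rewrite -e4 subrr add0r.
have nmt' : m - t != 0 by rewrite -opprB oppr_eq0.
have slope : legendre_cubic' x4 =
    2 * y1 * t + (x4 - x1) * (3 * (x1 + x4) - 2 * (1 + l)).
  have <- : legendre_cubic' x1 = 2 * y1 * t.
    by rewrite /t mulrC divfK // mulf_neq0.
  by rewrite /legendre_cubic'; ring.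
rewrite -ey4 eqr_opp_self (negPf ny4) /= -/(legendre_cubic' x4) slope.
rewrite ey4 /y3; clear slope sec hPP hPR nSN nSP nDN et nx nd e4 ny4 ey4 hP hR.
clear y4 y3; rewrite em eA e3; rewrite {}e3 in ne; clearbody t m x3 x4.
rewrite {}ey1.
have ny : - (m + t) * (x4 - x1) + m * (x4 - x1) * 2 != 0.
  have -> : - (m + t) * (x4 - x1) + m * (x4 - x1) * 2 = (m - t) * (x4 - x1) by ring.
  exact: mulf_neq0.
by congr (Some (_, _)); field; rewrite ne two_neq0 ny.
Qed.

Lemma on_legendre_mul n P : on P -> on (mul n P).
Proof. by move=> hP; elim: n => //= n IHn; apply: on_legendre_add. Qed.

Lemma legendre_mul_double n P : on P -> mul n (add P P) = mul n.*2 P.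
Proof.
by move=> hP; elim: n => //= n ->; rewrite legendre_add_double // on_legendre_mul.
Qed.

Lemma legendre_mul_modn n k P : mul n P = None -> mul k P = mul (k %% n)%N P.
Proof.
move=> nP; rewrite {1}(divn_eq k n) addnC /legendre_mul iterD; congr iter.
elim: (k %/ n)%N => [|q IHq]; first by rewrite mul0n.
by rewrite mulSn iterD IHq.
Qed.

Lemma iter_legendre_double k P : on P -> iter k (fun Q => add Q Q) P = mul (2 ^ k) P.
Proof.
elim: k P => [|k IHk] P hP; first by rewrite /= legendre_addr0.
by rewrite iterSr IHk ?on_legendre_add // legendre_mul_double // expnS mul2n.
Qed.

Lemma torsion_double P : on P -> legendre_torsion l P -> legendre_torsion l (add P P).
Proof.
move=> hP [n n0 nP]; exists n => //.
by rewrite legendre_mul_double // (legendre_mul_modn _ nP) -muln2 modnMr.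
Qed.

Lemma torsion_half P : on P -> legendre_torsion l (add P P) -> legendre_torsion l P.
Proof.
move=> hP [n n0]; rewrite legendre_mul_double // => nP.
by exists n.*2; rewrite ?double_gt0.
Qed.

(** If n = 2^a b with b odd, then 2^(a + phi(b)) and 2^a agree modulo n. *)
Lemma torsion_periodic P : on P -> legendre_torsion l P ->
  exists i k : nat, iter k.+1 (fun Q => add Q Q) (iter i (fun Q => add Q Q) P) =
    iter i (fun Q => add Q Q) P.
Proof.
move=> hP [n n0 nP].
have [b cop2b en] := pfactor_coprime (isT : prime 2) n0.
set a := logn 2 n in en; have b0 : (0 < b)%N by move: n0; rewrite en; case: (b).
exists a, (totient b).-1.
rewrite prednK ?totient_gt0 // -iterD !iter_legendre_double //.
rewrite (legendre_mul_modn _ nP) [RHS](legendre_mul_modn _ nP); congr legendre_mul.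
rewrite expnD en -{3}[(2 ^ a)%N]mul1n -!muln_modl.
by rewrite (Euler_exp_totient cop2b).
Qed.

Definition doubled_abscissa (x : F) : F :=
  (x ^+ 2 - l) ^+ 2 / (4 * (x * (x - 1) * (x - l))).

Lemma double_affine x y : on (Some (x, y)) -> y != 0 ->
  exists y', add (Some (x, y)) (Some (x, y)) = Some (doubled_abscissa x, y').
Proof.
move=> /= /eqP hP ny; have := legendre_add_tangent x ny => /= ->.
set x' := _ - x; exists (legendre_cubic' x / (2 * y) * (x - x') - y).
congr (Some (_, _)).
have fourE : (2 * y) ^+ 2 = 4 * (x * (x - 1) * (x - l)) by rewrite -hP; ring.
rewrite /doubled_abscissa /x' -fourE; apply: (canRL (mulfK _)).
  by rewrite expf_neq0 // mulf_neq0.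
set m := legendre_cubic' x / (2 * y).
have em : m * (2 * y) = legendre_cubic' x by rewrite divfK // mulf_neq0.
transitivity ((m * (2 * y)) ^+ 2 + (1 + l - x - x) * (2 * y) ^+ 2); first by ring.
by rewrite em fourE /legendre_cubic'; ring.
Qed.

Lemma ordinate_neq0 x y : on (Some (x, y)) ->
  x != 0 -> x - 1 != 0 -> x - l != 0 -> y != 0.
Proof.
move=> /= /eqP hP x0 x1 xl; apply: contra_eq_neq hP => ->.
by rewrite expr0n /= eq_sym !mulf_neq0.
Qed.

Lemma torsion_two x : legendre_torsion l (Some (x, 0)).
Proof. by exists 2; rewrite //= oppr0 !eqxx. Qed.

End LegendreLaw.

(** * Valuation rings in which 2 is not invertible *)

Definition dyadic_valuation_ring (F : fieldType) (A : subringClosed F) : Prop :=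
  2^-1 \notin A /\ forall x : F, x \notin A -> x^-1 \in A.

(** Subring structures are carried by boolean predicates, while unions of chains
    and the ring generated by an element are formed as sets. *)
Definition pred_of_set (T : Type) (X : set T) : {pred T} := fun z => z \in X.

Section Maximal.
Variables (F : fieldType) (A : subringClosed F).
Hypotheses (two_neq0 : (2 : F) != 0) (half : 2^-1 \notin A).
Hypothesis (Amax : forall B : subringClosed F, {subset A <= B} -> 2^-1 \notin B ->
  {subset B <= A}).

Definition adjoin (x : F) : set F :=
  [set z | exists2 p : {poly F}, p \is a polyOver A & z = p.[x]].

Lemma adjoin_half (x : F) : x \notin A ->
  exists2 p : {poly F}, p \is a polyOver A & p.[x] = 2^-1.
Proof.
move=> xA.
have sub : subring_closed (pred_of_set (adjoin x)).
  split; rewrite ?inE.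
  - by exists 1; rewrite ?rpred1 ?hornerC.
  - move=> u v; rewrite !inE => -[p pA ->] [q qA ->].
    by exists (p - q); rewrite ?rpredB ?hornerE.
  - move=> u v; rewrite !inE => -[p pA ->] [q qA ->].
    by exists (p * q); rewrite ?rpredM ?hornerE.
pose B : subringClosed F := HB.pack (pred_of_set (adjoin x))
  (GRing.isSubringClosed.Build F _ sub).
have sAB : {subset A <= B}.
  by move=> z zA; rewrite inE; exists z%:P; rewrite ?polyOverC ?hornerC.
have xB : x \in B by rewrite inE; exists 'X; rewrite ?polyOverX ?hornerX.
case: (boolP (2^-1 \in B)) => [|hB]; first by rewrite inE => -[p pA ->]; exists p.
by case/negP: xA; apply: (Amax sAB hB).
Qed.

(** With w = 1 - 2b, an expression of 1/2 as a polynomial in 1/w would give, after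
    multiplication by a power of w, that w^n / 2 is in A, while w^n is congruent to
    1 modulo 2A. *)
Lemma inv_one_sub_double b : b \in A -> (1 - 2 * b)^-1 \in A.
Proof.
move=> bA; set w := 1 - 2 * b; apply: contraNT half => /adjoin_half[p pA epw].
have w0 : w != 0.
  apply: contraNneq half => /eqP; rewrite subr_eq0 => /eqP e.
  by have -> : 2^-1 = b by apply: (mulfI two_neq0); rewrite mulfV.
have [c cA ec] : exists2 c, c \in A & w ^+ (size p) = 1 - 2 * c.
  elim: (size p) => [|n [c cA ec]].
    by exists 0; rewrite ?rpred0 // mulr0 subr0.
  exists (b + c - 2 * b * c); last by rewrite exprS ec /w; ring.
  by rewrite rpredB ?rpredD ?rpredM ?rpred_nat.
have : w ^+ size p * p.[w^-1] \in A.
  rewrite horner_coef mulr_sumr rpred_sum // => i _.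
  have -> : w ^+ size p = w ^+ (size p - i) * w ^+ i by rewrite -exprD subnK // ltnW.
  rewrite mulrA [_ * p`_i]mulrAC -!mulrA -exprMn mulfV // expr1n mulr1.
  by rewrite mulrC rpredM ?rpredX ?(polyOverP pA) // rpredB ?rpred1 ?rpredM ?rpred_nat.
rewrite epw ec mulrBl mul1r mulrAC mulfV // mul1r => h.
by rewrite -(subrK c 2^-1) rpredD.
Qed.

(** The relation 2 q(1/x) = 1 reads (1 - 2 q_0) x^n = 2 (q_1 x^(n-1) + ... + q_n)
    after multiplication by x^n.  As 1 - 2 q_0 is invertible in A, it rewrites the
    leading monomial of p in terms of lower ones. *)
Lemma lower_degree_half (x : F) (p q : {poly F}) :
  x != 0 -> p \is a polyOver A -> q \is a polyOver A ->
  p.[x] = 2^-1 -> q.[x^-1] = 2^-1 -> (size q <= size p)%N ->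
  exists p', [/\ p' \is a polyOver A, p'.[x] = 2^-1 & (size p' < size p)%N].
Proof.
move=> x0 pA qA px qx le_qp.
have p_neq0 : p != 0.
  apply: contraTneq (invr_neq0 two_neq0) => p0.
  by rewrite -px p0 horner0 eqxx.
have [n en] : exists n, size p = n.+1.
  by exists (size p).-1; rewrite prednK // size_poly_gt0.
set c := (1 - 2 * q`_0)^-1.
have cA : c \in A by rewrite inv_one_sub_double // (polyOverP qA).
have w0 : 1 - 2 * q`_0 != 0.
  apply: contraNneq half => /eqP; rewrite subr_eq0 => /eqP e.
  have -> : 2^-1 = q`_0 by apply: (mulfI two_neq0); rewrite mulfV.
  exact: (polyOverP qA).
pose g := \poly_(j < n) (2 * c * q`_(n - j)).
have gA : g \is a polyOver A.
  by apply/polyOver_poly => j _; rewrite !rpredM ?rpred_nat ?(polyOverP qA).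
have gx : g.[x] = x ^+ n.
  have sq : (size q <= n.+1)%N by rewrite -en.
  have := qx; rewrite (horner_coef_wide _ sq) big_ord_recl expr0 mulr1 => e.
  have : \sum_(i < n) q`_i.+1 * x^-1 ^+ i.+1 = 2^-1 - q`_0 by rewrite -e addrC addKr.
  move=> {}e; rewrite horner_poly.
  transitivity (2 * c * x ^+ n * \sum_(i < n) q`_i.+1 * x^-1 ^+ i.+1); last first.
    have e2 : 2 * (2^-1 - q`_0) = 1 - 2 * q`_0 by rewrite mulrBr mulfV.
    by rewrite e mulrAC [2 * c]mulrC -[c * 2 * _]mulrA e2 mulVf // mul1r.
  rewrite (reindex_inj rev_ord_inj) mulr_sumr; apply: eq_bigr => i _ /=.
  rewrite subKn // -!mulrA; congr (_ * (_ * _)); rewrite [RHS]mulrCA; congr (_ * _).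
  by rewrite exprVn; apply: (canRL (mulfK (expf_neq0 _ x0))); rewrite -exprD subnK.
exists (p - p`_n *: 'X^n + p`_n *: g); split.
- by rewrite rpredD ?rpredB ?polyOverZ ?(polyOverP pA) ?polyOverXn.
- by rewrite !hornerE gx px subrK.
rewrite en ltnS; apply/leq_sizeP => j le_nj.
rewrite !coefE ltnNge le_nj /= mulr0 addr0.
have [->|ne] := eqVneq j n; first by rewrite mulr1 subrr.
by rewrite mulr0 subr0 nth_default // en ltn_neqAle eq_sym ne.
Qed.

(** If neither x nor 1/x were in A, both would generate 1/2 over A by maximality,
    and the degrees of the two expressions could be lowered forever. *)
Lemma maximal_dyadic : dyadic_valuation_ring A.
Proof.
split=> // x xA; apply: contraNT xA => x'A.
case: (boolP (x \in A)) => // xA.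
have [p pA px] := adjoin_half xA; have [q qA qx] := adjoin_half x'A.
have x0 : x != 0 by apply: contraNneq xA => ->; rewrite rpred0.
elim: {p q}_.+1 {-2}p {-2}q (ltnSn (size p + size q)) pA qA px qx => // N IHN p q.
rewrite ltnS => le pA qA px qx.
have [le_qp|/ltnW le_pq] := leqP (size q) (size p).
  have [p' [p'A p'x lt]] := lower_degree_half x0 pA qA px qx le_qp.
  by apply: (IHN p' q) => //; apply: leq_trans le; rewrite ltn_add2r.
have [|q' [q'A q'x lt]] := lower_degree_half (invr_neq0 x0) qA pA qx _ le_pq.
  by rewrite invrK.
by apply: (IHN p q') => //; apply: leq_trans le; rewrite ltn_add2l.
Qed.

End Maximal.

(** The ring of integers starts the maximality argument: in characteristic 0 it
    does not contain 1/2. *)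
Lemma exists_dyadic_valuation_ring (F : numFieldType) :
  exists A : subringClosed F, dyadic_valuation_ring A.
Proof.
(* The empty set is admitted so that the empty chain has an upper bound. *)
pose P (X : set F) := X = set0 \/ subring_closed (pred_of_set X) /\ ~ X 2^-1.
have two0 : (2 : F) != 0 by rewrite pnatr_eq0.
have [|X [PX Xmax]] := @Zorn_bigcup F P.
  move=> C CP Ctot.
  have [C0|C0] := pselect (exists2 X, C X & X !=set0); last first.
    by left; rewrite -subset0 => z [X CX Xz]; apply: C0; exists X => //; exists z.
  right; split; last first.
    by move=> [X CX Xh]; case: (CP X CX) => [X0|[_]] //; rewrite X0 in Xh.
  have ring X z : C X -> X z -> subring_closed (pred_of_set X).
    by move=> CX Xz; case: (CP X CX) => [X0|[]] //; rewrite X0 in Xz.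
  have both u v : u \in \bigcup_(X in C) X -> v \in \bigcup_(X in C) X ->
      exists2 X, C X & [/\ u \in X, v \in X & subring_closed (pred_of_set X)].
    rewrite !inE => -[X CX Xu] [Y CY Yv].
    have [XY|YX] := Ctot X Y CX CY.
      by exists Y => //; rewrite !inE; split=> //; [exact: XY | exact: ring Yv].
    by exists X => //; rewrite !inE; split=> //; [exact: YX | exact: ring Xu].
  split.
  - case: C0 => X CX [z Xz]; have [X1 _ _] := ring X z CX Xz.
    by rewrite inE; exists X => //; rewrite -[X _]inE.
  - move=> u v uC vC; have [X CX [uX vX [_ XB _]]] := both u v uC vC.
    by rewrite inE; exists X => //; have := XB u v uX vX; rewrite inE.
  - move=> u v uC vC; have [X CX [uX vX [_ _ XM]]] := both u v uC vC.
    by rewrite inE; exists X => //; have := XM u v uX vX; rewrite inE.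
case: PX => [X0|[Xring Xhalf]].
  pose Z : set F := [set z | exists m : int, z = m%:~R].
  have : X `<` Z.
    rewrite X0; split; first exact: sub0set.
    by move=> /(_ 0); apply; exists 0.
  move=> /Xmax[]; right; split.
    split; rewrite ?inE; first by exists 1.
      by move=> u v; rewrite !inE => -[m ->] [n ->]; exists (m - n); rewrite rmorphB.
    by move=> u v; rewrite !inE => -[m ->] [n ->]; exists (m * n); rewrite rmorphM.
  move=> [m /(congr1 ( *%R 2))]; rewrite mulfV // -[1]/(1%:~R) -[2]/(2%:~R) -intrM.
  move/eqP; rewrite eqr_int => /eqP; lia.
pose A : subringClosed F := HB.pack (pred_of_set X)
  (GRing.isSubringClosed.Build F _ Xring).
exists A; apply: maximal_dyadic => //; first by apply/negP; rewrite inE.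
move=> B AB hB z zB.
case: (boolP (z \in A)) => // zA.
case: (Xmax [set` B]).
  split; last by move=> BX; case/negP: zA; rewrite inE; apply: BX.
  by move=> u Xu; apply: AB; rewrite inE.
right; split; last by rewrite /= (negPf hB).
by split=> [|u v|u v]; rewrite !inE /=; [apply: rpred1|apply: rpredB|apply: rpredM].
Qed.

(** * Integrality of roots of unity and of torsion points *)

Lemma four_neq0 (F : fieldType) : (2 : F) != 0 -> (4 : F) != 0.
Proof. by move=> two0; rewrite (_ : 4 = 2 * 2) ?mulf_neq0 // -natrM. Qed.

Section Dyadic.
Variables (F : fieldType) (A : subringClosed F).
Hypotheses (two_neq0 : (2 : F) != 0) (Adyadic : dyadic_valuation_ring A).

Let half : 2^-1 \notin A.
Proof. by case: Adyadic. Qed.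

Let inv_mem x : x \notin A -> x^-1 \in A.
Proof. by case: Adyadic => _; apply. Qed.

Let four0 : (4 : F) != 0 := four_neq0 two_neq0.

Lemma not_one_eq_double x : x \in A -> 1 != 2 * x.
Proof.
move=> xA; apply: contraNneq half => e.
by have -> : 2^-1 = x by apply: (mulfI two_neq0); rewrite mulfV.
Qed.

Lemma unity_integral z n : (0 < n)%N -> z ^+ n = 1 -> z \in A.
Proof.
case: n => // n _ zn; apply: contraT => zA; case/negP: (zA); have z'A := inv_mem zA.
have -> : z = z^-1 ^+ n.
  have zn0 : z ^+ n != 0.
    by apply: contra_eq_neq zn => z0; rewrite exprS z0 mulr0 eq_sym oner_neq0.
  by rewrite exprVn -[RHS]mul1r; apply: (canRL (mulfK zn0)); rewrite -exprS.
exact: rpredX.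
Qed.

Lemma sqrt_integral x : x ^+ 2 \in A -> x \in A.
Proof.
move=> x2A; apply: contraT => xA; case/negP: (xA); have x'A := inv_mem xA.
have x0 : x != 0 by apply: contraNneq xA => ->; rewrite rpred0.
by rewrite -[x](mulfK x0) -expr2 rpredM.
Qed.

(** Non-units of A form an ideal, so [b] and [1 - b] cannot both be non-units. *)
Lemma inv_one_sub b : b \in A -> b^-1 \notin A -> (1 - b)^-1 \in A.
Proof.
move=> bA b'A; case: (boolP (_ \in A)) => // cA; case/negP: b'A.
have b0 : b != 0 by apply: contraNneq cA => ->; rewrite subr0 invr1 rpred1.
have b1 : 1 - b != 0 by apply: contraNneq cA => ->; rewrite invr0 rpred0.
have : b / (1 - b) \notin A.
  apply: contra cA => h; have -> : (1 - b)^-1 = 1 + b / (1 - b) by field.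
  by rewrite rpredD ?rpred1.
move=> /inv_mem h; have -> : b^-1 = 1 + (b / (1 - b))^-1 by field; rewrite b0 b1.
by rewrite rpredD ?rpred1.
Qed.

(** The quotient of z^n - 1 by z - 1 is a sum of n powers of z, congruent to the
    odd number n modulo 2A, hence nonzero. *)
Lemma odd_unity_eq1 z n : odd n -> z ^+ n = 1 -> (z - 1) / 2 \in A -> z = 1.
Proof.
move=> n_odd zn zA; apply/eqP; rewrite -subr_eq0; apply/negPn/negP => z1.
have pow i : exists2 c, c \in A & z ^+ i = 1 + 2 * c.
  elim: i => [|i [c cA ei]]; first by exists 0; rewrite ?rpred0 // mulr0 addr0.
  exists ((z - 1) / 2 * (1 + 2 * c) + c); last by rewrite exprS ei; field.
  by rewrite rpredD // rpredM // rpredD ?rpred1 // rpredM ?rpred_nat.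
have [c cA ec] : exists2 c, c \in A & \sum_(i < n) z ^+ i = n%:R + 2 * c.
  elim: (n) => [|m [c cA ec]].
    by exists 0; rewrite ?rpred0 // big_ord0 mulr0 addr0.
  have [d dA ed] := pow m; exists (c + d); first exact: rpredD.
  by rewrite big_ord_recr /= ec ed -natr1; ring.
have : (z - 1) * \sum_(i < n) z ^+ i = 0 by rewrite -subrX1 zn subrr.
move/eqP; rewrite mulf_eq0 (negPf z1) ec /= -[n]odd_double_half n_odd.
rewrite natrD -muln2 natrM => /eqP e.
have := @not_one_eq_double (- (n./2%:R + c)).
rewrite rpredN rpredD ?rpred_nat // => /(_ isT)/eqP; apply.
by apply/eqP; rewrite -subr_eq0 -e; apply/eqP => /=; ring.
Qed.

(** Squaring preserves the congruence and halves an even exponent; and -1 is not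
    congruent to 1 modulo 4A. *)
Lemma unity_eq1 z n : (0 < n)%N -> z ^+ n = 1 -> (z - 1) / 4 \in A -> z = 1.
Proof.
elim: n {-2}n (leqnn n) z => [|N IHN] n; first by case: n.
move=> le_n z n0 zn zA; have zA2 : (z - 1) / 2 \in A.
  have -> : (z - 1) / 2 = 2 * ((z - 1) / 4) by field; rewrite four0.
  by rewrite rpredM ?rpred_nat.
have [n_odd|n_even] := boolP (odd n); first exact: odd_unity_eq1 n_odd zn zA2.
have en : n = (2 * n./2)%N by lia.
have z2 : z ^+ 2 = 1.
  apply: (IHN n./2); [lia|lia|by rewrite -exprM -en|].
  have -> : (z ^+ 2 - 1) / 4 = ((z - 1) / 4) * (2 + 4 * ((z - 1) / 4)) by field.
  by rewrite rpredM // rpredD ?rpred_nat // rpredM ?rpred_nat.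
move/eqP: z2; rewrite sqrf_eq1 => /orP[/eqP //|/eqP ez].
have := @not_one_eq_double (- ((z - 1) / 4)).
by rewrite rpredN zA => /(_ isT)/eqP[]; rewrite ez; field.
Qed.

(** The square of 1 + 2c is 1 + 4c(1 + c), to which [unity_eq1] applies. *)
Lemma unity_eq_pm1 z n : (0 < n)%N -> z ^+ n = 1 -> (z - 1) / 2 \in A ->
  (z == 1) || (z == - 1).
Proof.
move=> n0 zn zA; rewrite -sqrf_eq1; apply/eqP; apply: (@unity_eq1 _ n) => //.
  by rewrite exprAC zn expr1n.
have -> : (z ^+ 2 - 1) / 4 = ((z - 1) / 2) * (1 + ((z - 1) / 2)).
  by field; rewrite four0 two_neq0.
by rewrite rpredM // rpredD ?rpred1.
Qed.

Section Escape.
Variable l : F.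
Hypotheses (l_neq0 : l != 0) (l_neq1 : l != 1) (lA : l \in A).
Local Notation double := (fun Q => legendre_add l Q Q).

(** With w = 1/x, a non-unit of A, the quotient of x by the abscissa of the double
    is 4 (1 - w) (1 - l w) / (1 - l w^2)^2, whose denominator is a unit. *)
Lemma double_escape x y : on_legendre l (Some (x, y)) -> x \notin A ->
  exists x' y', [/\ double (Some (x, y)) = Some (x', y'), x' \notin A &
    exists2 a, a \in A & x = 2 * a * x'].
Proof.
move=> hP xA.
have x0 : x != 0 by apply: contraNneq xA => ->; rewrite rpred0.
have x1 : x - 1 != 0 by rewrite subr_eq0; apply: contraNneq xA => ->; rewrite rpred1.
have xl : x - l != 0 by rewrite subr_eq0; apply: contraNneq xA => ->.
have y0 := ordinate_neq0 hP x0 x1 xl.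
have [y' e] := double_affine two_neq0 hP y0.
have x2A : x ^+ 2 \notin A by apply: contra xA; apply: sqrt_integral.
have x2l : x ^+ 2 - l != 0 by rewrite subr_eq0; apply: contraNneq x2A => ->.
exists (doubled_abscissa l x), y'.
have ex : exists2 a, a \in A & x = 2 * a * doubled_abscissa l x.
  have wA := inv_mem xA; set w := x^-1 in wA.
  exists (2 * (1 - w) * (1 - l * w) * (1 - l * w ^+ 2)^-1 ^+ 2).
    rewrite rpredM ?rpredX //.
      by rewrite !rpredM ?rpredB ?rpredM ?rpred1 ?rpred_nat.
    apply: inv_one_sub; first by rewrite rpredM ?rpredX.
    rewrite invfM /w exprVn invrK; apply: contra x2A => h.
    by rewrite -[x ^+ 2](mulKf l_neq0) mulrCA rpredM.
  rewrite /w /doubled_abscissa; field.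
  by rewrite x0 x1 xl x2l four0.
split=> //; apply: contra xA => x'A; case: ex => a aA ->.
by rewrite rpredM // rpredM ?rpred_nat.
Qed.

Lemma iter_double_escape x y k : on_legendre l (Some (x, y)) -> x \notin A ->
  exists x' y', [/\ iter k double (Some (x, y)) = Some (x', y'), x' \notin A &
    exists2 a, a \in A & x = 2 ^+ k * a * x'].
Proof.
move=> hP xA; elim: k => [|k [x1 [y1 [e x1A [a aA ea]]]]].
  by exists x, y; split=> //; exists 1; rewrite ?rpred1 // expr0 !mul1r.
have h1 : on_legendre l (Some (x1, y1)).
  by rewrite -e iter_legendre_double // on_legendre_mul.
have [x' [y' [e' x'A [b bA eb]]]] := double_escape h1 x1A.
exists x', y'; split=> //; first by rewrite iterS e.
by exists (a * b); rewrite ?rpredM // ea eb exprS; ring.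
Qed.

(** Each doubling divides a non-integral abscissa by an element of 2A, so it never
    takes again an earlier value. *)
Lemma torsion_integral x y : on_legendre l (Some (x, y)) ->
  legendre_torsion l (Some (x, y)) -> x \in A.
Proof.
move=> hP torsP; case: (boolP (x \in A)) => // xA.
have [i [k per]] := torsion_periodic two_neq0 l_neq0 l_neq1 hP torsP.
have [x1 [y1 [e x1A _]]] := iter_double_escape i hP xA.
have h1 : on_legendre l (Some (x1, y1)).
  by rewrite -e iter_legendre_double // on_legendre_mul.
have [x2 [y2 [e' _ [a aA ea]]]] := iter_double_escape k.+1 h1 x1A.
move: per; rewrite e e' => -[ex _]; rewrite ex in ea.
have x10 : x1 != 0 by apply: contraNneq x1A => ->; rewrite rpred0.
have bA : 2 ^+ k * a \in A by rewrite rpredM ?rpredX ?rpred_nat.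
case/eqP: (not_one_eq_double bA).
by apply: (mulIf x10); rewrite mul1r {1}ea exprS; ring.
Qed.

End Escape.

End Dyadic.

(** * The two directions *)

(** The divisors of 12 that do not divide 4 are 3, 6 and 12. *)
Lemma order_3_6_12 (F : fieldType) (a : F) :
  [|| 3.-primitive_root a, 6.-primitive_root a | 12.-primitive_root a] =
  (a ^+ 12 == 1) && (a ^+ 4 != 1).
Proof.
apply/idP/andP => [|[/eqP a12 a4]].
  by case/or3P => pr; rewrite -!(prim_order_dvd pr).
have [m pr] := prim_order_exists (isT : (0 < 12)%N) a12.
rewrite -(prim_order_dvd pr) in a4.
rewrite dvdn_divisors // !inE => hm; move: pr a4.
by move: hm => /or4P[||| /or3P[]] /eqP-> prm //; rewrite prm ?orbT.
Qed.

Lemma mem_roots_of_unity (F : fieldType) (z : F) :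
  roots_of_unity F z <-> exists2 n, (0 < n)%N & z ^+ n = 1.
Proof.
by split=> -[n n0 zn]; exists n => //; [apply/unity_rootP|apply/unity_rootP].
Qed.

Section NegSquare.
Variables (F : fieldType) (a : F).
Hypotheses (two_neq0 : (2 : F) != 0) (a_neq0 : a != 0) (u_neq0 : a ^+ 2 - 1 != 0).
Local Notation l := (- a ^+ 2).
Local Notation double := (fun Q => legendre_add l Q Q).

Lemma quadruple_Nsq y : on_legendre l (Some (a, y)) ->
  exists z w, double (Some (a, y)) = Some (a ^+ 2 / (a ^+ 2 - 1), z) /\
    double (Some (a ^+ 2 / (a ^+ 2 - 1), z)) =
      Some ((a ^+ 4 - a ^+ 2 + 1) ^+ 2 / (4 * (a ^+ 2 * (a ^+ 2 - 1))), w).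
Proof.
move=> hP; have four0 := four_neq0 two_neq0.
have a1 : a - 1 != 0.
  by rewrite subr_eq0; apply: contraNneq u_neq0 => ->; rewrite expr1n subrr.
have al : a - l != 0.
  apply: contraNneq u_neq0 => e.
  have : (a - l) * (a - 1) = a * (a ^+ 2 - 1) by ring.
  by rewrite e mul0r => /esym/eqP; rewrite mulf_eq0 (negPf a_neq0).
have [z e] := double_affine two_neq0 hP (ordinate_neq0 hP a_neq0 a1 al).
have hQ := on_legendre_add two_neq0 hP hP; rewrite e in hQ.
have ex2 : doubled_abscissa l a = a ^+ 2 / (a ^+ 2 - 1).
  by rewrite /doubled_abscissa; field; rewrite u_neq0 al a1 a_neq0.
rewrite {}ex2 in e hQ.
have e1 : a ^+ 2 / (a ^+ 2 - 1) - 1 = (a ^+ 2 - 1)^-1 by field.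
have e2 : a ^+ 2 / (a ^+ 2 - 1) - l = a ^+ 4 / (a ^+ 2 - 1) by field.
have z0 : z != 0.
  apply: (ordinate_neq0 hQ); first by rewrite mulf_neq0 ?invr_eq0 ?expf_neq0.
    by rewrite e1 invr_eq0.
  by rewrite e2 mulf_neq0 ?invr_eq0 ?expf_neq0.
have [w e'] := double_affine two_neq0 hQ z0.
exists z, w; split; rewrite // e'; congr (Some (_, _)).
rewrite /doubled_abscissa e1 e2; field.
by rewrite a_neq0 u_neq0 four0.
Qed.

End NegSquare.

(** The integrality of x(2P) makes a^2 - l even, hence l = a^2 or l = -a^2; in the
    second case 2P does not have order 2, and the integrality of x(4P) makes
    a^4 - a^2 + 1 even. *)
Lemma torsion_params_unity_sub (F : numFieldType) (a l : F) :
  roots_of_unity F a -> roots_of_unity F l -> a != 1 ->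
  legendre_torsion_params a l ->
  [\/ l = a, l = a ^+ 2 | l = - a ^+ 2 /\ a ^+ 12 = 1 /\ a ^+ 4 != 1].
Proof.
move=> /mem_roots_of_unity[n n0 an] /mem_roots_of_unity[m m0 lm] a1.
move=> [l0 l1 [y [hP torsP]]].
have two0 : (2 : F) != 0 by rewrite pnatr_eq0.
have [A Ady] := exists_dyadic_valuation_ring F.
have a0 : a != 0.
  by apply: contra_eq_neq an => ->; rewrite expr0n (gtn_eqF n0) eq_sym oner_neq0.
have aA := unity_integral Ady n0 an; have lA := unity_integral Ady m0 lm.
have a'A : a^-1 \in A by apply: (unity_integral Ady n0); rewrite exprVn an invr1.
have a10 : a - 1 != 0 by rewrite subr_eq0.
have [->|nal] := eqVneq l a; first by constructor 1.
have al0 : a - l != 0 by rewrite subr_eq0 eq_sym.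
have y0 := ordinate_neq0 hP a0 a10 al0.
have [z e2] := double_affine two0 hP y0.
have hQ := on_legendre_add two0 hP hP.
have tQ := torsion_double two0 l0 l1 hP torsP.
have xA : doubled_abscissa l a \in A.
  by rewrite e2 in hQ tQ; apply: (torsion_integral two0 Ady l0 l1 lA hQ tQ).
have h2 : (a ^+ 2 - l) / 2 \in A.
  apply: (sqrt_integral Ady).
  have -> : ((a ^+ 2 - l) / 2) ^+ 2 = doubled_abscissa l a * a * (a - 1) * (a - l).
    by rewrite /doubled_abscissa; field; rewrite a0 a10 al0.
  by rewrite rpredM ?rpredB // rpredM ?rpredB ?rpred1 // rpredM.
have : (l / a ^+ 2 == 1) || (l / a ^+ 2 == - 1).
  apply: (@unity_eq_pm1 _ A two0 Ady _ (m * n)); first by rewrite muln_gt0 m0.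
    rewrite expr_div_n exprM lm expr1n -exprM [(m * n)%N]mulnC mulnCA.
    by rewrite exprM an expr1n divr1.
  have -> : (l / a ^+ 2 - 1) / 2 = - ((a ^+ 2 - l) / 2) * a^-1 ^+ 2 by field.
  by rewrite rpredM ?rpredN ?rpredX.
have a20 : a ^+ 2 != 0 by rewrite expf_neq0.
case/orP => /eqP e; first by constructor 2; rewrite -[l](divfK a20) e mul1r.
have {e} el : l = - a ^+ 2 by rewrite -[l](divfK a20) e mulN1r.
constructor 3; split=> //.
have a2 : a ^+ 2 != 1.
  rewrite sqrf_eq1 negb_or a1 /=; apply: contra_neq nal => e.
  by rewrite el e sqrrN expr1n.
have u1 : a ^+ 2 - 1 != 0 by rewrite subr_eq0.
subst l.
have [z' [w [d2 d4]]] := quadruple_Nsq two0 a0 u1 hP.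
rewrite {}d2 in hQ tQ.
have hR := on_legendre_add two0 hQ hQ.
have tR := torsion_double two0 l0 l1 hQ tQ.
rewrite {}d4 in hR tR.
have x4A := torsion_integral two0 Ady l0 l1 lA hR tR.
have h3 : (a ^+ 4 - a ^+ 2 + 1) / 2 \in A.
  apply: (sqrt_integral Ady).
  have four0 := four_neq0 two0.
  have -> : ((a ^+ 4 - a ^+ 2 + 1) / 2) ^+ 2 =
     (a ^+ 4 - a ^+ 2 + 1) ^+ 2 / (4 * (a ^+ 2 * (a ^+ 2 - 1)))
       * a ^+ 2 * (a ^+ 2 - 1).
    by field; rewrite a0 u1.
  apply: rpredM; first by apply: rpredM => //; apply: rpredX.
  by rewrite rpredB ?rpredX ?rpred1.
(* u^3 + 1 = (u + 1) (u^2 - u + 1), with u = a^2. *)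
have : (- a ^+ 6 == 1) || (- a ^+ 6 == - 1).
  apply: (@unity_eq_pm1 _ A two0 Ady _ (2 * n)); first by rewrite muln_gt0.
    by rewrite exprM sqrrN -!exprM mulnA mulnC exprM an expr1n.
  have -> : (- a ^+ 6 - 1) / 2 =
      - (a ^+ 2 + 1) * ((a ^+ 4 - a ^+ 2 + 1) / 2) by field.
  by rewrite rpredM ?rpredN ?rpredD ?rpredX ?rpred1.
move=> h; have a12 : a ^+ 12 = 1.
  have -> : a ^+ 12 = (- a ^+ 6) ^+ 2 by ring.
  by apply/eqP; rewrite sqrf_eq1.
split=> //; apply: contraTneq h3 => a4; rewrite a4.
(* Here u = -1, and u^2 - u + 1 = 3 is not in 2A. *)
have /eqP : (a ^+ 2) ^+ 2 = 1 by rewrite -exprM.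
rewrite sqrf_eq1 (negPf a2) /= => /eqP ->.
apply/negP => h3; have : 2^-1 = (1 - -1 + 1) / 2 - 1 :> F by field.
by move=> e; case: Ady => /negP[]; rewrite e rpredB ?rpred1.
Qed.

Section Converse.
Variable F : numClosedFieldType.

Let two0 : (2 : F) != 0.
Proof. by rewrite pnatr_eq0. Qed.

Lemma exists_ordinate (l x : F) : exists y, on_legendre l (Some (x, y)).
Proof. by exists (sqrtC (x * (x - 1) * (x - l))); rewrite /= sqrtCK. Qed.

Lemma torsion_params_self (a : F) : a != 0 -> a != 1 -> legendre_torsion_params a a.
Proof.
move=> a0 a1; split=> //; exists 0; split; last exact: torsion_two.
by rewrite /= subrr mulr0 expr0n.
Qed.

Lemma torsion_params_sq (a : F) : a != 0 -> a ^+ 2 != 1 ->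
  legendre_torsion_params a (a ^+ 2).
Proof.
move=> a0 a2; have a20 : a ^+ 2 != 0 by rewrite expf_neq0.
have a1 : a != 1 by apply: contraNneq a2 => ->; rewrite expr1n.
split=> //; have [y hP] := exists_ordinate (a ^+ 2) a.
exists y; split=> //; apply: torsion_half => //.
have y0 : y != 0.
  apply: (ordinate_neq0 hP); rewrite ?subr_eq0 //.
  by rewrite -subr_eq0 -{1}[a]mulr1 expr2 -mulrBr mulf_neq0 // subr_eq0 eq_sym.
have [z e] := double_affine two0 hP y0; have := on_legendre_add two0 hP hP.
rewrite e /doubled_abscissa subrr expr0n /= mul0r !mul0r sqrf_eq0 => /eqP ->.
exact: torsion_two.
Qed.

Lemma torsion_params_Nsq (a : F) : a ^+ 12 = 1 -> a ^+ 4 != 1 ->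
  legendre_torsion_params a (- a ^+ 2).
Proof.
move=> a12 a4; set l := - a ^+ 2.
have a0 : a != 0 by apply: contra_eq_neq a12 => ->; rewrite expr0n /= eq_sym oner_neq0.
have l0 : l != 0 by rewrite oppr_eq0 expf_neq0.
have l1 : l != 1.
  have e4 : a ^+ 4 = l ^+ 2 by rewrite /l; ring.
  by apply: contraNneq a4 => e; rewrite e4 e expr1n.
have u1 : a ^+ 2 - 1 != 0.
  rewrite subr_eq0; apply: contraNneq a4 => e.
  by rewrite (exprM a 2 2) e expr1n.
split=> //; have [y hP] := exists_ordinate l a.
exists y; split=> //; apply: torsion_half => //.
have [z [w [e e']]] := quadruple_Nsq two0 a0 u1 hP.
have hQ := on_legendre_add two0 hP hP; rewrite e in hQ *.
have hR := on_legendre_add two0 hQ hQ; rewrite e' in hR.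
(* u^6 - 1 = (u^2 - 1) (u^2 - u + 1) (u^2 + u + 1), with u = a^2. *)
have : (a ^+ 4 - 1) * ((a ^+ 4 - a ^+ 2 + 1) * (a ^+ 4 + a ^+ 2 + 1)) = 0.
  by transitivity (a ^+ 12 - 1); [ring|rewrite a12 subrr].
move/eqP; rewrite !mulf_eq0 subr_eq0 (negPf a4) /= => /orP[/eqP h|/eqP h].
  apply: torsion_half => //; rewrite e'; move: hR.
  rewrite h expr0n /= mul0r mul0r mul0r sqrf_eq0 => /eqP ->.
  exact: torsion_two.
have ex : (a ^+ 4 - a ^+ 2 + 1) ^+ 2 / (4 * (a ^+ 2 * (a ^+ 2 - 1))) =
    a ^+ 2 / (a ^+ 2 - 1).
  have -> : a ^+ 4 - a ^+ 2 + 1 = - 2 * a ^+ 2.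
    by apply/eqP; rewrite -subr_eq0 -h; apply/eqP; ring.
  by field; rewrite a0 u1.
(* 2Q has the abscissa of Q, and 2Q = Q is impossible, so 2Q = -Q. *)
rewrite ex in e' hR; set Q := Some _ in e' hQ *.
case: (eq_abscissa hQ hR) => ew; rewrite ew in e'.
  have := legendre_addKl two0 l0 l1 hQ hQ; rewrite -/Q in e'.
  by rewrite e' legendre_addNr.
exists 3 => //.
have -> : legendre_mul l 3 Q = legendre_add l Q (legendre_add l Q Q) by [].
by rewrite e'; exact: (legendre_addrN l Q).
Qed.

End Converse.

Theorem proposition13 (R : realType) (alpha : R[i])
    (alpha_mu : roots_of_unity R[i] alpha) (alpha_neq1 : alpha != 1) :
  legendre_torsion_params alpha `&` roots_of_unity R[i] =
    if alpha == -1 then [set alpha]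
    else if [|| 3.-primitive_root alpha, 6.-primitive_root alpha
              | 12.-primitive_root alpha]
    then [set alpha; alpha ^+ 2; - alpha ^+ 2]
    else [set alpha; alpha ^+ 2].
Proof.
rewrite order_3_6_12.
have /mem_roots_of_unity[n n0 an] := alpha_mu.
have a0 : alpha != 0.
  by apply: contra_eq_neq an => ->; rewrite expr0n (gtn_eqF n0) eq_sym oner_neq0.
have sq_mu : roots_of_unity R[i] (alpha ^+ 2).
  by apply/mem_roots_of_unity; exists n => //; rewrite exprAC an expr1n.
have Nsq_mu : roots_of_unity R[i] (- alpha ^+ 2).
  apply/mem_roots_of_unity; exists (2 * n)%N; first by rewrite muln_gt0.
  by rewrite exprM sqrrN -!exprM mulnA mulnC exprM an expr1n.
have self := conj (torsion_params_self a0 alpha_neq1) alpha_mu.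
apply/seteqP; split=> [l [lT l_mu]|l].
  have [->|el|[el [a12 a4]]] := torsion_params_unity_sub alpha_mu l_mu alpha_neq1 lT.
  - by case: ifP => _ //; case: ifP => _; [left; left|left].
  - have [e|_] := eqVneq alpha (- 1).
      by case: lT => _ /eqP[]; rewrite el e sqrrN expr1n.
    by case: ifP => _; [left; right|right].
  - have [e|_] := eqVneq alpha (- 1).
      by case/eqP: a4; rewrite e (exprM _ 2 2) sqrrN !expr1n.
    by rewrite a12 eqxx a4; right.
have [e|am1] := eqVneq alpha (- 1); first by move=> /= ->.
have a2 : alpha ^+ 2 != 1 by rewrite sqrf_eq1 negb_or alpha_neq1.
case: ifP => [/andP[/eqP a12 a4]|_] /=.
  move=> [[->|->]|->] //; split=> //; first exact: torsion_params_sq.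
  exact: torsion_params_Nsq.
by move=> [->|->] //; split=> //; exact: torsion_params_sq.
Qed.
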